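(* Let $p(\lambda)=1+\sum_{j=1}^d a_j\lambda^j\in\mathbb{C}[\lambda]$ be a scalar polynomial which is stable with respect to the open upper half-plane $H_0$. Then for every $A\in\mathbb{C}^{n,n}$ $$\|p(A)\|\leq\exp\Bigl(\|A\|\sqrt{d\,(|a_1|^2-2\operatorname{Re}a_2)}\Bigr).$$
   Context: $H_0=\{\lambda\in\mathbb{C}:\operatorname{Im}\lambda>0\}$. A scalar polynomial is stable with respect to $H_0$ if it has no roots in $H_0$. The norm $\|\cdot\|$ is the operator two-norm (spectral norm) of a matrix. If $d=1$, then $a_2=0$. For polynomials as in the statement the quantity $|a_1|^2-2\operatorname{Re}a_2$ is non-negative, so the square root is that of a non-negative real number. *)

(* Defs.v *)
From HB Require Import structures.
From mathcomp Require Import all_boot all_order all_algebra.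
From mathcomp Require Import all_classical all_reals complex.

Set Implicit Arguments.
Unset Strict Implicit.
Unset Printing Implicit Defensive.

Import Order.TTheory GRing.Theory Num.Theory.

Local Open Scope classical_set_scope.
Local Open Scope complex_scope.
Local Open Scope ring_scope.

(* [R[i]] is the field of complex numbers over [R : realType].  Its canonical
   norm [`|z|] is valued in [R[i]], so the [R]-valued modulus [Normc.normc]
   is used wherever a real number is needed. *)

Definition upper_half_plane (R : realType) : set R[i] :=
  [set z : R[i] | 0 < complex.Im z].
Arguments upper_half_plane R : clear implicits.

Definition stable (R : realType) (H : set R[i]) (p : {poly R[i]}) : Prop :=
  forall z : R[i], H z -> ~~ root p z.

Definition vnorm2 (R : realType) (n : nat) (x : 'cV[R[i]]_n) : R :=
  Num.sqrt (\sum_i Normc.normc (x i ord0) ^+ 2).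

(* [sup] is [0] on sets that are empty or unbounded above; by
   [has_sup_spectral_norm] below this convention plays no role when the
   dimension is positive. *)
Definition spectral_norm (R : realType) (n : nat) (A : 'M[R[i]]_n) : R :=
  sup [set vnorm2 (A *m x) | x in [set x : 'cV[R[i]]_n | vnorm2 x = 1]].

Lemma has_sup_spectral_norm (R : realType) (n : nat) (A : 'M[R[i]]_n.+1) :
  has_sup [set vnorm2 (A *m x) | x in [set x : 'cV[R[i]]_n.+1 | vnorm2 x = 1]].
Proof.
have nc0 (z : R[i]) : 0 <= Normc.normc z by case: z => a b; apply: sqrtr_ge0.
split.
  pose e : 'cV[R[i]]_n.+1 := delta_mx ord0 ord0.
  exists (vnorm2 (A *m e)); exists e => //=.
  rewrite /vnorm2 (bigD1 ord0) //= big1 => [|i ne_i0].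
    by rewrite mxE !eqxx Normc.normc1 expr1n addr0 sqrtr1.
  by rewrite mxE (negbTE ne_i0) Normc.normc0 expr0n.
exists (Num.sqrt (\sum_i (\sum_j Normc.normc (A i j)) ^+ 2)).
move=> _ [x /= x1 <-]; apply: ler_wsqrtr; apply: ler_sum => i _.
have x_le1 j : Normc.normc (x j ord0) <= 1.
  rewrite -[leRHS]x1 /vnorm2 -(ger0_norm (nc0 _)) -sqrtr_sqr.
  apply: ler_wsqrtr; rewrite (bigD1 j) //= lerDl.
  by apply: sumr_ge0 => k _; apply: sqr_ge0.
have le_ncD (I : finType) (F : I -> R[i]) :
    Normc.normc (\sum_j F j) <= \sum_j Normc.normc (F j).
  elim/big_ind2: _ => [|u a v b leu lev|//]; first by rewrite Normc.normc0.
  by apply: le_trans (le_normcD _ _) _; apply: lerD.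
rewrite lerXn2r ?nnegrE ?nc0 ?sumr_ge0 // mxE.
apply: le_trans (le_ncD _ _) _; apply: ler_sum => j _.
by rewrite Normc.normcM ler_piMr.
Qed.

(* Main.v *)
(* Write [p = \prod_j (1 - c_j X)] with [c_j] the inverses of the roots, so that
   [Im c_j >= 0] by stability.  Since all the [Im c_j] have the same sign,
   [\sum_j |c_j|^2 <= |a_1|^2 - 2 Re a_2]; hence
   [||p(A)|| <= \prod_j (1 + |c_j| ||A||) <= exp (||A|| \sum_j |c_j|)]
   and Cauchy-Schwarz bounds [\sum_j |c_j|]. *)

Require Import Defs.
From HB Require Import structures.
From mathcomp Require Import all_boot all_order all_algebra.
From mathcomp Require Import all_classical all_reals sequences exp complex.
From mathcomp Require Import lra.

Set Implicit Arguments.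
Unset Strict Implicit.
Unset Printing Implicit Defensive.

Import Order.TTheory GRing.Theory Num.Theory.

Local Open Scope complex_scope.
Local Open Scope ring_scope.

(** Stated over a list so that it serves both the coordinates of a vector and the inverse roots [c]
    of the polynomial. In the induction only the cross term has to be controlled. *)
Lemma cauchy_schwarz_sum (F : realFieldType) (I : Type) (s : seq I)
    (f g : I -> F) :
  (\sum_(i <- s) f i * g i) ^+ 2 <=
  (\sum_(i <- s) f i ^+ 2) * (\sum_(i <- s) g i ^+ 2).
Proof.
elim: s => [|i s IHs]; first by rewrite !big_nil expr0n mul0r.
rewrite !big_cons; move: (f i) (g i) => x y.
have: 0 <= \sum_(j <- s) f j ^+ 2 by apply: sumr_ge0 => j _; apply: sqr_ge0.
have: 0 <= \sum_(j <- s) g j ^+ 2 by apply: sumr_ge0 => j _; apply: sqr_ge0.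
move: IHs; set a := \sum_(j <- s) f j ^+ 2; set b := \sum_(j <- s) g j ^+ 2.
set c := \sum_(j <- s) f j * g j => c2_le b_ge0 a_ge0.
suff: 2 * (c * (x * y)) <= a * y ^+ 2 + b * x ^+ 2 by lra.
apply: le_trans (ler_norm _) _.
have rhs_ge0 : 0 <= a * y ^+ 2 + b * x ^+ 2.
  by apply: addr_ge0; apply: mulr_ge0 => //; apply: sqr_ge0.
rewrite -(ler_pXn2r (ltn0Sn 1)) ?nnegrE ?normr_ge0 // real_normK ?num_real //.
(* This is AM-GM: it gives [4ab(xy)^2 <= (ay^2 + bx^2)^2], while [c^2 <= ab] bounds the square of
   the cross term by the left side. *)
have : 0 <= (a * y ^+ 2 - b * x ^+ 2) ^+ 2 by apply: sqr_ge0.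
have : c ^+ 2 * (x * y) ^+ 2 <= a * b * (x * y) ^+ 2.
  by rewrite ler_wpM2r ?sqr_ge0.
by lra.
Qed.

Lemma normc_ge0 (R : rcfType) (z : R[i]) : 0 <= Normc.normc z.
Proof. by case: z => a b; apply: sqrtr_ge0. Qed.

Lemma sqr_normc (R : rcfType) (z : R[i]) :
  Normc.normc z ^+ 2 = complex.Re z ^+ 2 + complex.Im z ^+ 2.
Proof. by case: z => a b; rewrite /= sqr_sqrtr // addr_ge0 ?sqr_ge0. Qed.

Section EuclideanNorm.
Variables (R : realType) (n : nat).
Implicit Types (x y : 'cV[R[i]]_n) (c : R[i]).

Lemma vnorm2_ge0 x : 0 <= vnorm2 x.
Proof. exact: sqrtr_ge0. Qed.

Lemma sqr_vnorm2 x : vnorm2 x ^+ 2 = \sum_i Normc.normc (x i ord0) ^+ 2.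
Proof. by rewrite sqr_sqrtr // sumr_ge0 // => i _; apply: sqr_ge0. Qed.

Lemma vnorm2_eq0 x : vnorm2 x = 0 -> x = 0.
Proof.
move=> x0; apply/colP => i; rewrite mxE.
have /eqP := sqr_vnorm2 x; rewrite x0 expr0n eq_sym psumr_eq0; last first.
  by move=> j _; apply: sqr_ge0.
move=> /allP /(_ i (mem_index_enum _)).
by rewrite /= expf_eq0 /= => /eqP /Normc.eq0_normc.
Qed.

Lemma vnorm2Z c x : vnorm2 (c *: x) = Normc.normc c * vnorm2 x.
Proof.
apply/eqP; rewrite -(eqrXn2 (ltn0Sn 1)) ?mulr_ge0 ?normc_ge0 ?vnorm2_ge0 //.
rewrite exprMn !sqr_vnorm2 mulr_sumr; apply/eqP/eq_bigr => i _.
by rewrite mxE Normc.normcM exprMn.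
Qed.

Lemma ler_vnorm2D x y : vnorm2 (x + y) <= vnorm2 x + vnorm2 y.
Proof.
rewrite -(ler_pXn2r (ltn0Sn 1)) ?nnegrE ?addr_ge0 ?vnorm2_ge0 //.
have cs : \sum_i Normc.normc (x i ord0) * Normc.normc (y i ord0) <=
    vnorm2 x * vnorm2 y.
  rewrite -(ler_pXn2r (ltn0Sn 1)) ?nnegrE ?mulr_ge0 ?vnorm2_ge0 //; last first.
    by apply: sumr_ge0 => i _; rewrite mulr_ge0 ?normc_ge0.
  by rewrite exprMn !sqr_vnorm2; apply: cauchy_schwarz_sum.
rewrite sqrrD !sqr_vnorm2 -mulr_natl.
apply: (@le_trans _ _ (\sum_i (Normc.normc (x i ord0) +
    Normc.normc (y i ord0)) ^+ 2)).
  apply: ler_sum => i _; rewrite lerXn2r ?nnegrE ?addr_ge0 ?normc_ge0 //.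
  by rewrite mxE; apply: le_normcD.
under eq_bigr do rewrite sqrrD -mulr_natl.
by rewrite !big_split /= -mulr_sumr lerD2r lerD2l ler_pM2l.
Qed.

End EuclideanNorm.

Section SpectralNorm.
Variables (R : realType) (n : nat) (A : 'M[R[i]]_n.+1).

(** The supremum runs over unit vectors only, so a nonzero [x] is first rescaled by the inverse of
    its norm. *)
Lemma vnorm2_mulmx_le (x : 'cV[R[i]]_n.+1) :
  vnorm2 (A *m x) <= spectral_norm A * vnorm2 x.
Proof.
have [x0|x_neq0] := eqVneq (vnorm2 x) 0.
  by rewrite (vnorm2_eq0 x0) mulmx0 -(scale0r 0) vnorm2Z Normc.normc0 mul0r mulr0.
have x_gt0 : 0 < vnorm2 x by rewrite lt0r x_neq0 vnorm2_ge0.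
rewrite -ler_pdivrMr //.
have normcV : Normc.normc (vnorm2 x)^-1%:C = (vnorm2 x)^-1.
  by rewrite /= expr0n addr0 sqrtr_sqr ger0_norm // invr_ge0 ltW.
apply: ub_le_sup; first by case: (has_sup_spectral_norm A).
exists ((vnorm2 x)^-1%:C *: x) => /=; first by rewrite vnorm2Z normcV mulVf.
by rewrite -scalemxAr vnorm2Z normcV mulrC.
Qed.

Lemma spectral_norm_le (M : R) :
  (forall x, vnorm2 (A *m x) <= M * vnorm2 x) -> spectral_norm A <= M.
Proof.
move=> A_le; apply: ge_sup; first by case: (has_sup_spectral_norm A).
by move=> _ [x /= x1 <-]; rewrite -[M]mulr1 -x1.
Qed.

Lemma spectral_norm_ge0 : 0 <= spectral_norm A.
Proof.
have [[r Ar] A_ub] := has_sup_spectral_norm A.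
apply: le_trans (ub_le_sup A_ub Ar).
by case: Ar => x _ <-; apply: vnorm2_ge0.
Qed.

(** Factors are peeled off one at a time: [1 - cA] stretches a vector by at most [1 + ||A|| |c|],
    which is at most [exp (||A|| |c|)], and the exponents add up. *)
Lemma vnorm2_horner_mx_prod_le (s : seq R[i]) (x : 'cV[R[i]]_n.+1) :
  vnorm2 (horner_mx A (\prod_(c <- s) (1 - c *: 'X)) *m x) <=
  expR (spectral_norm A * \sum_(c <- s) Normc.normc c) * vnorm2 x.
Proof.
elim: s => [|c s IHs].
  by rewrite !big_nil mulr0 expR0 mul1r rmorph1 mul1mx.
rewrite !big_cons rmorphM rmorphB rmorph1 /= linearZ /= horner_mx_X.
rewrite -mulmxE -mulmxA mulmxBl mul1mx -scalemxAl -scaleNr.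
set y := horner_mx A _ *m x in IHs *.
apply: le_trans (ler_vnorm2D _ _) _; rewrite vnorm2Z.
have -> : Normc.normc (- c) = Normc.normc c.
  by case: (c) => a b; rewrite /= !sqrrN.
have y_ge0 := vnorm2_ge0 y.
apply: (@le_trans _ _ ((1 + spectral_norm A * Normc.normc c) * vnorm2 y)).
  rewrite mulrDl mul1r lerD2l [spectral_norm A * _]mulrC -mulrA.
  by rewrite ler_wpM2l ?normc_ge0 ?vnorm2_mulmx_le.
rewrite mulrDr expRD -mulrA ler_pM ?expR_ge1Dx //.
by rewrite addr_ge0 ?mulr_ge0 ?spectral_norm_ge0 ?normc_ge0.
Qed.

End SpectralNorm.

(** By Newton's identity [p_1^2 - 2 p_2 = \sum c^2], the right side exceeds the left by
    [2 ((\sum Im c)^2 - \sum (Im c)^2)], which is nonnegative when all [Im c >= 0]. *)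
Lemma sum_sqr_normc_le_coef (R : rcfType) (s : seq R[i])
    (p := \prod_(c <- s) (1 - c *: 'X)) :
  (forall c, c \in s -> 0 <= complex.Im c) ->
  \sum_(c <- s) Normc.normc c ^+ 2 <=
  Normc.normc p`_1 ^+ 2 - complex.Re p`_2 *+ 2.
Proof.
(* The induction needs the sign of [Im p`_1]: the cross term is
   [4 * Im c * Im p`_1]. *)
suff H : (forall c, c \in s -> 0 <= complex.Im c) ->
    [/\ p`_0 = 1, complex.Im p`_1 <= 0 &
      \sum_(c <- s) Normc.normc c ^+ 2 <=
      Normc.normc p`_1 ^+ 2 - complex.Re p`_2 *+ 2].
  by move=> /H [].
rewrite {}/p; elim: s => [|c s IHs] s_ge0.
  by rewrite !big_nil !coef1 /= expr0n /= addr0 sqrtr0 expr0n mul0rn subr0.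
have c_ge0 : 0 <= complex.Im c by apply: s_ge0; rewrite mem_head.
have [|p0 p1_le0 IH] := IHs.
  by move=> z zs; apply: s_ge0; rewrite inE zs orbT.
rewrite !big_cons mulrBl mul1r -scalerAl !coefB !coefZ !coefXM /= p0.
split.
- by rewrite mulr0 subr0.
- move: c_ge0 p1_le0; rewrite mulr1.
  by case: (c) (_`_1) => [a b] [u v] /=; lra.
(* The coefficients become [p_1 - c] and [p_2 - c p_1], so the right side grows by [|c|^2 - 4bv]
   with [b = Im c] and [v = Im p_1]. *)
- move: IH c_ge0 p1_le0; rewrite mulr1 !sqr_normc.
  move: (\sum_(_ <- _) _) (c) (_`_1) (_`_2) => S [a b] [u v] [e f] /=.
  move=> IH b_ge0 v_le0; have : b * v <= 0 by rewrite mulr_ge0_le0.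
  by lra.
Qed.

(** As [p(0) = 1], no root is zero, so the roots can be inverted. They lie in the closed lower
    half-plane, and inversion reverses the sign of the imaginary part. *)
Lemma stable_poly_prod (R : realType) (p : {poly R[i]}) :
    stable (upper_half_plane R) p -> p`_0 = 1 ->
  exists s : seq R[i], [/\ p = \prod_(c <- s) (1 - c *: 'X),
    forall c, c \in s -> 0 <= complex.Im c & (size s).+1 = size p].
Proof.
move=> p_stable p0.
have [r p_eq] := closed_field_poly_normal p.
have p_neq0 : p != 0 by apply: contra_eq_neq p0 => ->; rewrite coef0 eq_sym oner_eq0.
have lp : lead_coef p != 0 by rewrite lead_coef_eq0.
have r_root z : z \in r -> root p z.
  by move=> zr; rewrite p_eq rootZ ?root_prod_XsubC.
have r_neq0 z : z \in r -> z != 0.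
  move=> /r_root; apply: contraTneq => ->.
  by rewrite /root horner_coef0 p0 oner_eq0.
exists [seq z^-1 | z <- r]; split.
(* Factorwise, [1 - z^-1 X = - z^-1 (X - z)]. *)
- have -> : \prod_(c <- [seq z^-1 | z <- r]) (1 - c *: 'X) =
      (\prod_(z <- r) - z^-1) *: \prod_(z <- r) ('X - z%:P).
    rewrite big_map -scaler_prod big_seq [RHS]big_seq; apply: eq_bigr => z zr.
    rewrite scalerBr -!mul_polyC -polyCM mulNr mulVf ?r_neq0 // !polyCN.
    by rewrite mulNr opprK polyC1 addrC.
  rewrite {1}p_eq; congr (_ *: _).
  set q := \prod_(z <- r) ('X - z%:P) in p_eq *.
  (* The constant term 1 determines the leading coefficient: it is the inverse of [\prod (- z)]. *)
  have : lead_coef p * q`_0 = 1 by rewrite -coefZ -p_eq.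
  have -> : q`_0 = \prod_(z <- r) - z.
    rewrite -horner_coef0 horner_prod; apply: eq_bigr => z _.
    by rewrite !hornerE.
  move=> /(congr1 (fun u => u * \prod_(z <- r) - z^-1)).
  rewrite mul1r -mulrA -big_split /= big1_seq ?mulr1 // => z /andP[_ zr].
  by rewrite mulrNN mulfV ?r_neq0.
- move=> _ /mapP[z zr ->]; have z_neq0 := r_neq0 z zr.
  have z_le0 : complex.Im z <= 0.
    rewrite leNgt; apply/negP => /p_stable; rewrite (r_root z zr) //.
  case: z z_le0 {zr z_neq0} => a b /= b_le0.
  by rewrite oppr_ge0 mulr_le0_ge0 ?invr_ge0 ?addr_ge0 ?sqr_ge0.
- by rewrite size_map p_eq size_scale // size_prod_XsubC.
Qed.

Theorem proposition4p12 (R : realType) (d : nat) (d_gt0 : (0 < d)%N)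
    (p : {poly R[i]})
    (p_def : p = 1 + \sum_(1 <= j < d.+1) p`_j *: 'X^j)
    (p_stable : stable (upper_half_plane R) p)
    (n : nat) (A : 'M[R[i]]_n.+1) :
  spectral_norm (horner_mx A p) <=
    expR (spectral_norm A *
      Num.sqrt (d%:R * (Normc.normc p`_1 ^+ 2 - complex.Re p`_2 *+ 2))).
Proof.
(* [p_def] is used through two facts: the constant term is 1 and the degree is at most [d]. The
   coefficient of [X^d] may vanish, and for [d = 1] the degree bound forces [p_2 = 0]. *)
have p0 : p`_0 = 1.
  rewrite p_def coefD coef1 coef_sum big_nat big1 ?addr0 // => j /andP[j_gt0 _].
  by rewrite coefZ coefXn; case: j j_gt0 => // j _; rewrite mulr0.
have size_p : (size p <= d.+1)%N.
  rewrite p_def; apply: leq_trans (size_polyD _ _) _.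
  rewrite geq_max size_poly1 /= big_nat.
  apply: (big_ind (fun q : {poly R[i]} => size q <= d.+1)%N) => [|u v ? ?|j].
  - by rewrite size_poly0.
  - by apply: leq_trans (size_polyD _ _) _; rewrite geq_max; apply/andP.
  - move=> /andP[_ j_lt]; apply: leq_trans (size_scale_leq _ _) _.
    by rewrite size_polyXn.
have [s [p_eq s_ge0 size_s]] := stable_poly_prod p_stable p0.
apply: spectral_norm_le => x; rewrite {1}p_eq.
apply: le_trans (vnorm2_horner_mx_prod_le _ _ _) _.
rewrite ler_wpM2r ?vnorm2_ge0 // ler_expR ler_wpM2l ?spectral_norm_ge0 //.
have S_ge0 : 0 <= \sum_(c <- s) Normc.normc c.
  by apply: sumr_ge0 => c _; apply: normc_ge0.
rewrite -(ger0_norm S_ge0) -sqrtr_sqr ler_wsqrtr //.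
(* Against the constant 1, Cauchy-Schwarz gives [(\sum |c|)^2 <= size s * \sum |c|^2]. The two
   factors are then bounded separately, with [size s <= d] coming from the degree bound. *)
have := cauchy_schwarz_sum s (fun=> 1) (@Normc.normc R).
under eq_bigr do rewrite mul1r.
move=> /le_trans; apply.
apply: ler_pM.
- by apply: sumr_ge0 => c _; apply: sqr_ge0.
- by apply: sumr_ge0 => c _; apply: sqr_ge0.
- under eq_bigr do rewrite expr1n.
  by rewrite big_const_seq count_predT iter_addr_0 ler_nat -ltnS size_s.
- by rewrite p_eq; apply: sum_sqr_normc_le_coef.
Qed.
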